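(* There exists a (randomized) online algorithm for the Machine Covering problem on $m$ identical parallel machines whose competitive ratio in the random-order model is $\tilde{O}(\sqrt[4]{m})$, i.e. $O(\sqrt[4]{m}\cdot \mathrm{polylog}(m))$.
   Context: Machine Covering: an input is a set $\mathcal{J}=\{J_1,\dots,J_n\}$ of jobs with non-negative sizes $p_1,\dots,p_n$, to be assigned to $m$ identical parallel machines; the load of a machine is the total size of jobs assigned to it, and the objective is to maximize the minimum machine load. $\mathrm{OPT}(\mathcal{J})$ denotes the optimal (offline) minimum load. In the online version jobs are revealed one by one and each must be assigned permanently to a machine before the next one is revealed; the algorithm knows $n$ in advance. In the random-order model the adversary chooses the input set $\mathcal{J}$, and the arrival order is a permutation $\sigma$ chosen uniformly at random from the symmetric group $S_n$. For an online algorithm $A$, let $A(\mathcal{J}^\sigma)$ be its (expected, if $A$ is randomized) minimum load on the order $\sigma$, and $A^{\mathrm{rom}}(\mathcal{J})=\mathbb{E}_{\sigma\sim S_n}[A(\mathcal{J}^\sigma)]$. The competitive ratio of $A$ in the random-order model is $\sup_{\mathcal{J}} \mathrm{OPT}(\mathcal{J})/A^{\mathrm{rom}}(\mathcal{J})$, with the conventions $0/0=1$ and $a/0=\infty$ for $a>0$. *)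

(* Defs.v *)
From HB Require Import structures.
From mathcomp Require Import all_boot all_order all_algebra all_fingroup.
From mathcomp Require Import all_classical all_reals.
From mathcomp Require Import ereal exp.

Set Implicit Arguments. Unset Strict Implicit. Unset Printing Implicit Defensive.
Import Order.TTheory GRing.Theory Num.Theory.
Local Open Scope ring_scope.

Section MachineCovering.
Variable R : realType.

(* A (behavioural) randomized online algorithm: knowing the number m of
   machines and the number n of jobs, given the history (sizes of the jobs
   revealed so far together with the machines they were assigned to) and the
   size of the current job, it outputs a probability distribution over the
   m machines for the current job. *)
Definition online_alg := forall m n : nat, seq (R * 'I_m) -> R -> 'I_m -> R.

Definition valid_alg (A : online_alg) : Prop :=
  forall (m n : nat) (h : seq (R * 'I_m)) (x : R), (0 < m)%N ->
    (forall j, 0 <= A m n h x j) /\ \sum_(j < m) A m n h x j = 1.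

Definition load (m n : nat) (s : n.-tuple R) (a : n.-tuple 'I_m) (j : 'I_m) : R :=
  \sum_(i < n | tnth a i == j) tnth s i.

(* minimum machine load (the neutral element, the total size, is an upper
   bound of every load, so for m >= 1 this is the true minimum) *)
Definition minload (m n : nat) (s : n.-tuple R) (a : n.-tuple 'I_m) : R :=
  \big[Num.min/ \sum_(i < n) tnth s i]_(j < m) load s a j.

Definition OPT (m n : nat) (p : n.-tuple R) : R :=
  \big[Num.max/0]_(a : n.-tuple 'I_m) minload p a.

Definition assign_prob (A : online_alg) (m n : nat) (s : n.-tuple R)
    (a : n.-tuple 'I_m) : R :=
  \prod_(i < n) A m n (zip (take i s) (take i a)) (tnth s i) (tnth a i).

Definition alg_value (A : online_alg) (m n : nat) (s : n.-tuple R) : R :=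
  \sum_(a : n.-tuple 'I_m) assign_prob A s a * minload s a.

Definition arrival (n : nat) (p : n.-tuple R) (sigma : 'S_n) : n.-tuple R :=
  [tuple tnth p (sigma i) | i < n].

Definition rom_value (A : online_alg) (m n : nat) (p : n.-tuple R) : R :=
  (n`!)%:R^-1 * \sum_(sigma : 'S_n) alg_value A m (arrival p sigma).

Definition ratio (a b : R) : \bar R :=
  if b == 0 then (if a == 0 then 1%E else +oo%E) else (a / b)%:E.

Definition rom_comp_ratio (A : online_alg) (m : nat) : \bar R :=
  ereal_sup [set r | exists (n : nat) (p : n.-tuple R),
     (forall i, 0 <= tnth p i) /\ r = ratio (OPT m p) (rom_value A m p)].

End MachineCovering.

(* Main.v *)
Require Import Defs.
From HB Require Import structures.
From mathcomp Require Import all_boot all_order all_algebra all_fingroup.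
From mathcomp Require Import all_classical all_reals.
From mathcomp Require Import ereal exp.
From mathcomp Require Import zify ring lra.
Set Implicit Arguments. Unset Strict Implicit. Unset Printing Implicit Defensive.
Import Order.TTheory GRing.Theory Num.Theory.
Local Open Scope ring_scope.

(** Write [O] for the optimum, sort the jobs by nonincreasing size and let [s]
be about [m^(1/4)].  Greedy covers every machine with the [m]-th largest job,
so assume that this job is smaller than [O / (16 s)].  Let [d] be the number of
machines minus the number of jobs of size at least [O / 16].

The algorithm guesses [d] up to a factor 2 as [D], at the price of a logarithm,
and reserves [D] machines.  A binomially distributed prefix of the input serves
as a sample; its jobs go greedily to the unreserved machines.  The
algorithm then draws a rank uniformly from a window of width [O(sqrt m)] around
[m/2].  Later jobs not larger than the sample job of that rank are small and go
greedily to the reserved machines, the others go greedily to the unreserved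
ones.  If the sample job of the drawn rank is one of the [s] jobs of (overall)
rank [m, ..., m + s - 1], then the unreserved machines, treated greedily
throughout, each get load [O / 16] from the large jobs, and the unsampled half
of the remaining small jobs, whose volume is at least [d O / 2], covers the
reserved machines.

The sample is a uniformly random set of jobs, so by Chebyshev's inequality the
rank of each of these [s] jobs within the sample lies in the window with
probability at least 1/2.  Hence a good rank is drawn with probability of order
[s / sqrt m = m^(-1/4)]. *)

(** * Randomized strategies in behavioural form *)

Section Mixture.
Variables (R : realType) (m : nat) (I : finType).
Variable f : I -> seq (R * 'I_m.+1) -> R -> 'I_m.+1.

Fixpoint agrees (t : I) (pre h : seq (R * 'I_m.+1)) : bool :=
  if h is y :: h' then (f t pre y.1 == y.2) && agrees t (rcons pre y) h'
  else true.

Lemma agrees_rcons t pre h y :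
  agrees t pre (rcons h y) = agrees t pre h && (f t (pre ++ h) y.1 == y.2).
Proof.
elim: h pre => [|z h IH] pre /=; first by rewrite cats0 andbT.
by rewrite IH -andbA cat_rcons.
Qed.

Lemma agrees_exists t pre (s : seq R) :
  exists2 a : seq 'I_m.+1, size a = size s & agrees t pre (zip s a).
Proof.
elim: s pre => [|x s IH] pre; first by exists [::].
have [a sa Ha] := IH (rcons pre (x, f t pre x)).
by exists (f t pre x :: a); rewrite /= ?sa // eqxx.
Qed.

Definition consistent h := [set t | agrees t [::] h].

(* The behavioural form of the uniform mixture of the [f t]: the posterior
   probability, given the history, of the strategies that play [j]. *)
Definition mixture (h : seq (R * 'I_m.+1)) (x : R) (j : 'I_m.+1) : R :=
  if #|consistent h| == 0%N then (j == ord0)%:R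
  else #|consistent (rcons h (x, j))|%:R / #|consistent h|%:R.

Lemma mixture_ge0 h x j : 0 <= mixture h x j.
Proof. by rewrite /mixture; case: ifP => _; rewrite ?ler0n // divr_ge0 ?ler0n. Qed.

Lemma mixture_sum1 h x : \sum_j mixture h x j = 1.
Proof.
rewrite /mixture; have [_|h0] := eqVneq #|consistent h| 0%N.
  by rewrite (bigD1 ord0) //= big1 ?addr0 // => j /negPf ->.
rewrite -mulr_suml -natr_sum; have -> : (\sum_(j < m.+1)
    #|consistent (rcons h (x, j))| = #|consistent h|)%N.
  rewrite -[RHS]sum1_card (partition_big (fun t => f t h x) predT) //=.
  apply: eq_bigr => j _; rewrite -sum1_card; apply: eq_bigl => t.
  by rewrite !inE agrees_rcons.
by rewrite divff // pnatr_eq0.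
Qed.

(** The posteriors telescope. Once no strategy is consistent with the history, both sides are 0,
    whatever the default of [mixture]. *)
Lemma prod_mixture (s : seq R) (a : seq 'I_m.+1) k : (0 < #|I|)%N ->
    size a = size s -> (k <= size s)%N ->
  \prod_(i < k) mixture (zip (take i s) (take i a)) (nth 0 s i) (nth ord0 a i)
  = #|consistent (zip (take k s) (take k a))|%:R / #|I|%:R.
Proof.
move=> I0 sa; elim: k => [|k IH] lek.
  rewrite big_ord0 !take0 /= (_ : #|consistent [::]| = #|I|) ?divff //.
    by rewrite pnatr_eq0 -lt0n.
  by apply: eq_card => t; rewrite !inE.
rewrite big_ord_recr /= IH 1?ltnW //.
rewrite (take_nth 0) // (take_nth ord0) ?sa // zip_rcons; last first.
  by rewrite !size_take sa lek.
set h := zip _ _; rewrite /mixture; case: ifP => [/eqP c0|/negbT c0].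
  rewrite c0 mul0r mul0r (_ : #|_| = 0%N) ?mul0r //.
  apply/eqP; rewrite -leqn0 -c0; apply/subset_leq_card/fintype.subsetP => t.
  by rewrite !inE agrees_rcons => /andP[].
by rewrite mulrAC mulrCA divff ?mulr1 // pnatr_eq0.
Qed.

Lemma minload_ge0 n (s : n.-tuple R) (a : n.-tuple 'I_m.+1) :
  (forall i, 0 <= tnth s i) -> 0 <= minload s a.
Proof.
move=> s0; apply: le_bigmin => [|j _]; first by apply: sumr_ge0.
by apply: sumr_ge0.
Qed.

(** Exchanging the sums turns the value into an average over [t]. Each [t] agrees with some
    assignment, and all other terms are nonnegative. *)
Lemma alg_value_mixture (A : online_alg R) n (s : n.-tuple R) (v : I -> R) :
    (0 < #|I|)%N -> A m.+1 n = mixture -> (forall i, 0 <= tnth s i) ->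
    (forall t (a : n.-tuple 'I_m.+1), agrees t [::] (zip s a) ->
       v t <= minload s a) ->
  #|I|%:R^-1 * \sum_t v t <= alg_value A m.+1 s.
Proof.
move=> I0 AE s0 vP; rewrite /alg_value.
have -> : \sum_(a : n.-tuple 'I_m.+1) assign_prob A s a * minload s a =
  #|I|%:R^-1 * \sum_t \sum_(a : n.-tuple 'I_m.+1 | agrees t [::] (zip s a))
     minload s a.
  rewrite (exchange_big_dep predT) //= mulr_sumr; apply: eq_bigr => a _.
  have -> : assign_prob A s a = #|consistent (zip s a)|%:R / #|I|%:R.
    rewrite /assign_prob AE; under eq_bigr => i _ do
      rewrite (tnth_nth 0 s) (tnth_nth ord0 a).
    by rewrite prod_mixture ?size_tuple // !take_oversize ?size_tuple.
  rewrite sumr_const -[minload _ _ *+ _]mulr_natl mulrA [_^-1 * _]mulrC; congr (_ * _).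
  by congr (_%:R / _); apply: eq_card => t; rewrite !inE.
rewrite ler_wpM2l ?invr_ge0 ?ler0n //; apply: ler_sum => t _.
have [a sa Ha] := agrees_exists t [::] s.
have sa' : size a == n by rewrite sa size_tuple.
rewrite (bigD1 (Tuple sa')) //= -[leLHS]addr0 lerD ?vP //.
by apply: sumr_ge0 => b _; apply: minload_ge0.
Qed.
End Mixture.

(** * Greedy assignment on two groups of machines *)

Lemma card_ord_lt m D : #|[set j : 'I_m | (j < D)%N]| = minn D m.
Proof.
rewrite -sum1_card; under eq_bigl => j do rewrite inE.
have [le_Dm|/ltnW le_mD] := leqP D m.
  by rewrite -(big_ord_widen _ (fun=> 1%N) le_Dm) sum1_card card_ord.
rewrite (eq_bigl predT) ?sum1_card ?card_ord // => j.
exact: leq_trans (ltn_ord j) le_mD.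
Qed.

Lemma card_ord_ge m D : #|[set j : 'I_m | (D <= j)%N]| = (m - D)%N.
Proof.
have := cardsC [set j : 'I_m | (j < D)%N]; rewrite card_ord_lt card_ord.
rewrite (_ : ~: _ = [set j : 'I_m | (D <= j)%N]); first by lia.
by apply/setP => j; rewrite !inE -leqNgt.
Qed.

Section GreedyBalance.
Variables (R : realType) (m n : nat) (s : n.-tuple R) (a : n.-tuple 'I_m.+1).

Definition load_before (k : nat) (j : 'I_m.+1) : R :=
  \sum_(i < n | (i < k)%N && (tnth a i == j)) tnth s i.

Hypothesis s_ge0 : forall i, 0 <= tnth s i.

Lemma load_before_le k j : load_before k j <= load s a j.
Proof.
rewrite /load (bigID (fun i : 'I_n => (i < k)%N)) /=.
under eq_bigl => i do rewrite andbC.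
by rewrite -/(load_before k j) lerDl sumr_ge0.
Qed.

Lemma le_load_before k (i : 'I_n) : (i < k)%N -> tnth s i <= load_before k (tnth a i).
Proof.
by move=> ik; rewrite /load_before (bigD1 i) ?ik ?eqxx //= lerDl sumr_ge0.
Qed.

Lemma le_load (i : 'I_n) : tnth s i <= load s a (tnth a i).
Proof. exact: le_trans (le_load_before (ltnSn i)) (load_before_le _ _). Qed.

Variables (D : nat) (small : pred 'I_n) (v t : R).
Hypothesis smallP : forall i, small i -> (tnth a i < D)%N /\
  forall j : 'I_m.+1, (j < D)%N -> load_before i (tnth a i) <= load_before i j.
Hypothesis largeP : forall i, ~~ small i -> (D <= m)%N -> (D <= tnth a i)%N /\
  forall j : 'I_m.+1, (D <= j)%N -> load_before i (tnth a i) <= load_before i j.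
Hypotheses (t_ge0 : 0 <= t) (small_le : forall i, small i -> tnth s i <= t).
Hypothesis small_vol : D%:R * (v + t) <= \sum_(i < n | small i) tnth s i.
Hypothesis large_count :
  (m.+1 - D <= #|[set i | ~~ small i & (v <= tnth s i)%R]|)%N.

(** The last small job on [j'] chose a least loaded reserved machine, so the earlier small jobs on
    [j'] weigh at most the load of [j]; the last one weighs at most [t]. *)
Let small_vol_on (j j' : 'I_m.+1) : (j < D)%N -> (j' < D)%N ->
  \sum_(i < n | small i && (tnth a i == j')) tnth s i <= load s a j + t.
Proof.
move=> jD j'D.
case: (pickP [pred i | small i && (tnth a i == j')]) => /= [i0 Pi0|P0].
  case: (@arg_maxnP _ i0 [pred i | small i && (tnth a i == j')]
    (fun i => nat_of_ord i) Pi0) => /= i /andP[si /eqP aij] imax.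
  rewrite (bigD1 i) /= ?si ?aij ?eqxx // addrC lerD ?small_le //.
  apply: le_trans (load_before_le i j); have [_ /(_ j jD)] := smallP si.
  rewrite aij; apply: le_trans.
  rewrite /load_before [leRHS](bigID small) /= -[leLHS]addr0.
  rewrite lerD ?sumr_ge0 //.
  rewrite le_eqVlt; apply/orP; left; apply/eqP; apply: eq_bigl => i'.
  rewrite -[i' == i]val_eqE /=; have /= := imax i'.
  case: (small i'); case: (tnth a i' == j');
    rewrite /= ?andbF ?andbT //= => /(_ isT); lia.
rewrite big_pred0 // addr_ge0 //; exact: sumr_ge0.
Qed.

(** Suppose machine [j] has load below [v]. If it is reserved, the reserved machines together hold
    too little small volume. If not, the large jobs of size at least [v] lie on distinct unreserved
    machines other than [j], so there are too few of them. *)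
Lemma minload_ge_greedy : v <= minload s a.
Proof.
have loadP j : v <= load s a j.
  rewrite leNgt; apply/negP => jv.
  have [jD|Dj] := ltnP j D.
    suff : \sum_(i < n | small i) tnth s i < D%:R * (v + t).
      by rewrite ltNge small_vol.
    rewrite (partition_big (tnth a) (fun j : 'I_m.+1 => (j < D)%N)) /=; last first.
      by move=> i /smallP[].
    apply: (@le_lt_trans _ _ (D%:R * (load s a j + t))); last first.
      by rewrite ltr_pM2l ?ltrD2r // ltr0n; apply: leq_trans jD.
    apply: (@le_trans _ _ (\sum_(j' < m.+1 | (j' < D)%N) (load s a j + t))).
      by apply: ler_sum => j' j'D; exact: small_vol_on.
    rewrite sumr_const -[_ *+ #|_|]mulr_natl ler_wpM2r //.
      by rewrite addr_ge0 //; exact: sumr_ge0.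
    by rewrite ler_nat -cardsE card_ord_lt geq_minl.
  have Dm : (D <= m)%N by rewrite (leq_trans Dj) // -ltnS.
  pose X := [set i | ~~ small i & v <= tnth s i].
  have ainj : {in X &, injective (tnth a)}.
    suff lt_ne (i i' : 'I_n) : 
        i \in X -> i' \in X -> tnth a i = tnth a i' -> ~~ (i < i')%N.
      move=> i i' iX i'X aii'; apply/val_inj/eqP => /=; rewrite eqn_leq leqNgt.
      by rewrite lt_ne //= leqNgt lt_ne.
    rewrite !inE => /andP[_ vi] /andP[si' _] aii'; apply/negP => ii'.
    (* When [i'] arrives, its machine already holds [i] and has load at least [v], while [j] is
       still below [v]. *)
    have [_ /(_ j Dj)] := largeP si' Dm; apply/negP; rewrite -ltNge.
    apply: (le_lt_trans (load_before_le _ _)); apply: (lt_le_trans jv).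
    by rewrite (le_trans vi) // -aii' le_load_before.
  have : (#|tnth a @: X| <= #|[set j' : 'I_m.+1 | (D <= j')%N] :\ j|)%N.
    apply/subset_leq_card/fintype.subsetP => _ /imsetP[i + ->].
    rewrite !inE => /andP[si vi]; have [-> _] := largeP si Dm; rewrite andbT.
    apply/eqP => aij; move: jv; apply/negP; rewrite -leNgt.
    by rewrite (le_trans vi) // -aij le_load.
  have := cardsD1 j [set j' : 'I_m.+1 | (D <= j')%N].
  move: large_count; rewrite -/X card_ord_ge inE Dj card_in_imset //; lia.
apply: le_bigmin => [|j _ //]; apply: le_trans (loadP ord0) _.
rewrite [leRHS](bigID (fun i => tnth a i == ord0)) /=.
by rewrite lerDl sumr_ge0.
Qed.

End GreedyBalance.

Lemma big_take (T U : Type) (idx : U) (op : U -> U -> U) n (z : n.-tuple T) k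
    (P : pred T) (F : T -> U) : (k <= n)%N ->
  \big[op/idx]_(y <- take k z | P y) F y =
  \big[op/idx]_(i < n | (i < k)%N && P (tnth z i)) F (tnth z i).
Proof.
move=> kn; case: n z kn => [|n] z kn.
  by rewrite big_ord0 tuple0 big_nil.
have y0 := thead z; rewrite (big_nth y0) size_take size_tuple.
rewrite (_ : (if _ then _ else _) = k); last by case: ltngtP kn.
rewrite big_mkord (eq_bigl (fun i : 'I_k => P (nth y0 z i))); last first.
  by move=> i; rewrite nth_take.
rewrite (eq_bigr (fun i : 'I_k => F (nth y0 z i))); last first.
  by move=> i _; rewrite nth_take.
rewrite (big_ord_widen_cond _ (fun i => P (nth y0 z i))
  (fun i => F (nth y0 z i)) kn).
apply: eq_big => [i|i _]; by rewrite (tnth_nth y0) 1?andbC.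
Qed.

Lemma tnth_zip (T U : Type) n (s : n.-tuple T) (a : n.-tuple U) i :
  tnth (zip_tuple s a) i = (tnth s i, tnth a i).
Proof.
rewrite (tnth_nth (tnth s i, tnth a i)) nth_zip ?size_tuple //.
by rewrite -!tnth_nth.
Qed.

(** * The deterministic strategy for fixed parameters *)

Section Strategy.
Variables (R : realType) (m : nat).
Implicit Types (h : seq (R * 'I_m.+1)) (x : R).

Definition hist_load h (j : 'I_m.+1) : R := \sum_(y <- h | y.2 == j) y.1.

(* The first [k] jobs are the sample; a later job is small if it is at most the
   sample job of rank [c], counting ranks from 0. *)
Definition is_small (D c k : nat) h x : bool :=
  [&& (0 < D)%N, (k <= size h)%N &
      (c < count (fun y => x <= y.1)%R (take k h))%N].

(** The defaults satisfy the constraints of the minima: [is_small] forces [0 < D], so [ord0] is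
    reserved, and [ord_max] is unreserved whenever [D <= m]. *)
Definition step (D c k : nat) h x : 'I_m.+1 :=
  if is_small D c k h x then [arg min_(j < ord0 | (j < D)%N) hist_load h j]%O
  else [arg min_(j < ord_max | (D <= j)%N) hist_load h j]%O.

Lemma agrees_nth (I : finType) (f : I -> seq (R * 'I_m.+1) -> R -> 'I_m.+1) t
    pre h y0 i : agrees f t pre h -> (i < size h)%N ->
  f t (pre ++ take i h) (nth y0 h i).1 = (nth y0 h i).2.
Proof.
elim: h pre i => [|y h IH] pre [|i] //= /andP[/eqP fy Hh] ih.
  by rewrite cats0.
by rewrite -cat_rcons IH.
Qed.

Variables (n D c k : nat) (s : n.-tuple R) (a : n.-tuple 'I_m.+1).
Hypothesis kn : (k <= n)%N.

Definition small_pos (i : 'I_n) : bool :=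
  [&& (0 < D)%N, (k <= i)%N &
      (c < #|[set i' : 'I_n | (i' < k)%N & (tnth s i <= tnth s i')%R]|)%N].

Lemma hist_load_take i j :
  (i <= n)%N -> hist_load (take i (zip s a)) j = load_before s a i j.
Proof.
move=> le_in; rewrite /hist_load (big_take _ _ (zip_tuple s a)) //.
by apply: eq_big => [i'|i' _]; rewrite tnth_zip.
Qed.

Lemma is_small_take (i : 'I_n) :
  is_small D c k (take i (zip s a)) (tnth s i) = small_pos i.
Proof.
rewrite /is_small /small_pos size_take size1_zip ?size_tuple // ltn_ord.
have [ki|//] := leqP k i; congr [&& _, _ & (_ < _)%N].
rewrite take_takel // -sum1_count (big_take _ _ (zip_tuple s a)) // -sum1_card.
by apply: eq_bigl => i'; rewrite inE tnth_zip.
Qed.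

Lemma minload_step v t :
    (forall i : 'I_n, tnth a i = step D c k (take i (zip s a)) (tnth s i)) ->
    (forall i, 0 <= tnth s i) ->
    0 <= t -> (forall i, small_pos i -> tnth s i <= t) ->
    D%:R * (v + t) <= \sum_(i < n | small_pos i) tnth s i ->
    (m.+1 - D <= #|[set i | ~~ small_pos i & (v <= tnth s i)%R]|)%N ->
  v <= minload s a.
Proof.
move=> aE s0 t0; apply: minload_ge_greedy => // i si.
  have := aE i; rewrite /step is_small_take si => ->.
  have D0 : (0 < D)%N by case/andP: si.
  case: arg_minP => // j jD jmin; split => // j' j'D.
  by have := jmin j' j'D; rewrite !hist_load_take // ltnW.
move=> Dm; have := aE i; rewrite /step is_small_take (negbTE si) => ->.
case: arg_minP => // j jD jmin; split => // j' j'D.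
by have := jmin j' j'D; rewrite !hist_load_take // ltnW.
Qed.

End Strategy.

(** * Uniformly random subsets *)

Section RandomSubsets.
Variable T : finType.
Implicit Types (A B S U : {set T}).

(** List each set followed by its complement and match the two lists position by position. *)
Lemma perm_imset_exists A B : #|A| = #|B| -> exists s : {perm T}, s @: A = B.
Proof.
move=> cAB; pose e (X : {set T}) := enum X ++ enum (~: X).
have eU X : uniq (e X).
  rewrite cat_uniq !enum_uniq andbT /=; apply/hasPn => x.
  by rewrite !mem_enum inE.
have eT X x : x \in e X by rewrite mem_cat !mem_enum inE orbN.
have se X : size (e X) = #|T| by rewrite size_cat -!cardE cardsC.
have fi : injective (fun x => nth x (e B) (index x (e A))).
  move=> x y /eqP; rewrite (set_nth_default y) ?se -?(se A) ?index_mem //.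
  rewrite nth_uniq ?se -?(se A) ?index_mem // => /eqP xy.
  by rewrite -(nth_index y (eT A x)) xy nth_index.
exists (perm fi); apply/eqP; rewrite eqEcard card_imset ?cAB ?leqnn ?andbT; last first.
  exact: perm_inj.
apply/fintype.subsetP => _ /imsetP[x xA ->]; rewrite permE.
have xi : (index x (enum A) < #|B|)%N by rewrite -cAB cardE index_mem mem_enum.
by rewrite index_cat mem_enum xA nth_cat -cardE xi -mem_enum mem_nth // -cardE.
Qed.

Definition toggle U S : {set T} := [set x | (x \in S) (+) (x \in U)].

Lemma toggleK U : involutive (toggle U).
Proof. by move=> S; apply/setP => x; rewrite !inE -addbA addbb addbF. Qed.

(* Replaces independence: an involution that preserves [P] shows that [Q] has
   conditional probability at least 1/2 given [P]. *)
Lemma card_le_double (f : {set T} -> {set T}) (P Q : pred {set T}) :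
    involutive f -> (forall S, P (f S) = P S) -> (forall S, Q S || Q (f S)) ->
  (#|[set S | P S]| <= 2 * #|[set S | P S && Q S]|)%N.
Proof.
move=> fK Pf PQ; set X := [set S | P S && Q S].
have : [set S | P S] \subset X :|: f @: X.
  apply/fintype.subsetP => S; rewrite !inE => PS; rewrite PS /=.
  case/orP: (PQ S) => [->//|Qf]; apply/orP; right; apply/imsetP.
  by exists (f S); rewrite ?fK // inE Pf PS.
move/subset_leq_card/leq_trans; apply; rewrite mul2n -addnn.
apply: leq_trans (leq_card_setU _ _) _.
by rewrite leq_add2l leq_imset_card.
Qed.

Definition sgn_in (i : T) S : int := if i \in S then 1 else -1.

Lemma sum_sgn_in A S :
  \sum_(i in A) sgn_in i S = 2 * #|S :&: A|%:Z - #|A|%:Z.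
Proof.
rewrite (bigID (mem S)) /= (eq_bigr (fun=> 1)) => [|i /andP[_ iS]]; last first.
  by rewrite /sgn_in iS.
rewrite (eq_bigr (fun=> -1) (P := fun i => _ && ~~ _)); last first.
  move=> i /andP[_ /negPf iS].
  by rewrite /sgn_in iS.
have e1 : #|fun i => (i \in A) && (i \in S)| = #|S :&: A|.
  by apply: eq_card => x; rewrite !inE andbC.
have e2 : #|fun i => (i \in A) && (i \notin S)| = #|A :\: S|.
  by apply: eq_card => x; rewrite !inE andbC.
rewrite !sumr_const e1 e2 -[#|A|](cardsID S) [A :&: S]finset.setIC.
by rewrite mulNrn; lia.
Qed.

(** The diagonal terms are 1; toggling [i] flips the sign of every cross term of [i] with another
    [i'], so these cancel. *)
Lemma second_moment A :
  \sum_S (\sum_(i in A) sgn_in i S) ^+ 2 = (#|A| * 2 ^ #|T|)%:Z.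
Proof.
under eq_bigr => S _ do rewrite expr2 big_distrlr /=.
rewrite exchange_big /=; under eq_bigr => i _ do rewrite exchange_big /=.
rewrite (eq_bigr (fun=> (2 ^ #|T|)%:Z)) => [|i iA].
  by rewrite sumr_const -mulr_natl natz -PoszM.
rewrite (bigD1 i) //= [X in _ + X]big1 ?addr0 => [|i' /andP[_ i'i]].
  rewrite (eq_bigr (fun=> 1)) => [|S _]; last by rewrite /sgn_in; case: (i \in S).
  by rewrite sumr_const -cardsT -powersetT card_powerset cardsT natz.
set X := \sum_ _ _; suff : X = - X by lia.
rewrite {1}/X (reindex_inj (can_inj (toggleK [set i]))) /= -sumrN.
apply: eq_bigr => S _; rewrite /sgn_in !inE eqxx (negPf i'i) addbF addbT.
by case: (i \in S); case: (i' \in S).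
Qed.

(** For a bad [S] the signed sum has square above [4 * u ^ 2], so by the second moment at most half
    of all sets are bad. *)
Lemma chebyshev_subset A u : (0 < u)%N -> (#|A| <= 2 * u ^ 2)%N ->
  (2 ^ #|T| <= 2 * #|[set S | (#|A| <= 2 * #|S :&: A| + 2 * u)%N
                          && (2 * #|S :&: A| <= #|A| + 2 * u)%N]|)%N.
Proof.
move=> u0 Au; set X := [set S | _].
have : \sum_(S in ~: X) (4 * u ^ 2)%:Z <= (#|A| * 2 ^ #|T|)%:Z.
  rewrite -second_moment [leRHS](bigID (mem (~: X))) /=.
  rewrite -[leLHS]addr0 lerD ?sumr_ge0 // => [|S _]; last exact: sqr_ge0.
  by apply: ler_sum => S; rewrite !inE sum_sgn_in => SX; nia.
rewrite sumr_const -mulr_natl natz -PoszM lez_nat.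
have := cardsC X; rewrite -cardsT -powersetT card_powerset cardsT.
move: #|X| #|~: X| => x y; move: (2 ^ _)%N => N; nia.
Qed.

End RandomSubsets.

(* With a binomial length, the set of jobs in the initial segment is uniform
   among all sets of jobs. *)
Lemma sum_perm_initial_segment (R : pzRingType) n (G : {set 'I_n} -> R) :
  \sum_(sigma : 'S_n) \sum_(B : {set 'I_n})
     G (sigma @: [set i : 'I_n | (i < #|B|)%N]) = n`!%:R * \sum_S G S.
Proof.
rewrite exchange_big /=.
rewrite (eq_bigr (fun B : {set 'I_n} =>
  \sum_(sigma : 'S_n) G (sigma @: B))) => [|B _].
  rewrite exchange_big /= (eq_bigr (fun=> \sum_S G S)) => [|sigma _].
    by rewrite sumr_const mulr_natl card_Sn.
  by rewrite [RHS](reindex_inj (imset_inj (@perm_inj _ sigma))).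
have [pi piB] : exists pi : 'S_n, pi @: B = [set i : 'I_n | (i < #|B|)%N].
  apply: perm_imset_exists; rewrite card_ord_lt; apply/esym/minn_idPl.
  by rewrite -[leqRHS]card_ord max_card.
rewrite [RHS](reindex_inj (mulgI pi)); apply: eq_bigr => sigma _.
by rewrite -piB -imset_comp; congr G; apply: eq_imset => i; rewrite /= permM.
Qed.

(** * The algorithm *)

Lemma root4_exists m : exists s, (m <= s ^ 4)%N.
Proof. by exists m; case: m => // m; rewrite -[leqLHS]expn1 leq_pexp2l. Qed.

Definition root4 m := ex_minn (root4_exists m).

Section Algorithm.
Variable R : realType.

(** With [s = root4 m.+1], the rank within the sample is typically within [s ^ 2] of half the
    overall rank. The width [3 * s ^ 2] also absorbs the spread [s] of the overall ranks and
    rounding. *)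
Definition rank_base m : nat := (m./2 - root4 m.+1 ^ 2)%N.
Definition num_guesses m : nat := (trunc_log 2 m.+1).+2.
Definition num_ranks m : nat := (3 * root4 m.+1 ^ 2)%N.

(* The guess [i] stands for [2 ^ i - 1] reserved machines, so [i = 0] is plain
   greedy.  Only the cardinal of the set in [{set 'I_n}] is used: it is the
   sample size. *)
Definition params m n : finType :=
  ('I_(num_guesses m) * 'I_(num_ranks m) * {set 'I_n})%type.

Definition strategy m n (t : params m n) : seq (R * 'I_m.+1) -> R -> 'I_m.+1 :=
  step (2 ^ t.1.1).-1 (rank_base m + t.1.2) #|t.2|.

Definition covering_alg : online_alg R := fun m n =>
  match m return seq (R * 'I_m) -> R -> 'I_m -> R with
  | 0 => fun _ _ _ => 0
  | m.+1 => mixture (@strategy m n)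
  end.

Lemma covering_alg_valid : valid_alg covering_alg.
Proof.
move=> [//|m] n h x _; split => [j|]; first exact: mixture_ge0.
exact: mixture_sum1.
Qed.

Lemma root4_gt0 m : (0 < root4 m.+1)%N.
Proof. by rewrite /root4; case: ex_minnP => -[]. Qed.

Lemma root4P m : (m <= root4 m ^ 4)%N.
Proof. by rewrite /root4; case: ex_minnP. Qed.

Lemma root4_le m : (root4 m <= m)%N.
Proof.
rewrite /root4; case: ex_minnP => s _; apply; case: m => // m.
by rewrite -[leqLHS]expn1 leq_pexp2l.
Qed.

Lemma root4_pred m : (0 < m)%N -> ((root4 m).-1 ^ 4 < m)%N.
Proof.
move=> m0; rewrite /root4; case: ex_minnP => -[|s] _ smin //=.
by rewrite ltnNge; apply/negP => /smin; rewrite ltnn.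
Qed.

Lemma card_params m n :
  #|{: params m n}| = (num_guesses m * num_ranks m * 2 ^ n)%N.
Proof.
by rewrite !card_prod !card_ord -[#|{set _}|]cardsT -powersetT card_powerset
  cardsT card_ord.
Qed.

Definition sample n (sigma : 'S_n) (B : {set 'I_n}) : {set 'I_n} :=
  sigma @: [set i : 'I_n | (i < #|B|)%N].

Lemma mem_sample n (sigma : 'S_n) (B : {set 'I_n}) i :
  (sigma i \in sample sigma B) = (i < #|B|)%N.
Proof. by rewrite mem_imset ?inE //; exact: perm_inj. Qed.

(** * From random arrival orders to uniformly random samples *)

Section Value.
Variables (m n : nat) (p : n.-tuple R).
Hypothesis p_ge0 : forall i, 0 <= tnth p i.

(** Only the guess [i0] with good pairs of rank and sample is counted; everything else contributes
    at least 0. By [sum_perm_initial_segment] the sample ranges uniformly over all sets. *)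
Lemma rom_value_ge (i0 : 'I_(num_guesses m))
    (good : 'I_(num_ranks m) -> {set 'I_n} -> bool) (v : R) (N : nat) :
    0 <= v ->
    (forall sigma B r (a : n.-tuple 'I_m.+1), good r (sample sigma B) ->
       agrees (@strategy m n) (i0, r, B) [::] (zip (arrival p sigma) a) ->
       v <= minload (arrival p sigma) a) ->
    (N <= \sum_S \sum_r good r S)%N ->
  v * N%:R / (num_guesses m * num_ranks m * 2 ^ n)%:R
    <= rom_value covering_alg m.+1 p.
Proof.
move=> v0 vP NP; pose w sigma (t : params m n) : R :=
  if (t.1.1 == i0) && good t.1.2 (sample sigma t.2) then v else 0.
rewrite /rom_value.
apply: (@le_trans _ _ (n`!%:R^-1 * \sum_(sigma : 'S_n)
    (#|{: params m n}|%:R^-1 * \sum_t w sigma t))); last first.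
  rewrite ler_wpM2l ?invr_ge0 ?ler0n //; apply: ler_sum => sigma _.
  apply: alg_value_mixture => //.
  - by rewrite card_params /num_ranks !muln_gt0 !expn_gt0 root4_gt0.
  - by move=> i; rewrite tnth_mktuple.
  - move=> [[i r] B] a agr; rewrite /w /=.
    case: ifP => [/andP[/eqP ii0 gd]|_]; first by subst i; apply: vP gd agr.
    by apply: minload_ge0 => i'; rewrite tnth_mktuple.
rewrite -mulr_sumr card_params mulrCA [leLHS]mulrC.
rewrite ler_wpM2l ?invr_ge0 ?ler0n //.
have -> : \sum_(sigma : 'S_n) \sum_t w sigma t =
    n`!%:R * \sum_S v * (\sum_r good r S)%:R.
  rewrite -sum_perm_initial_segment; apply: eq_bigr => sigma _.
  rewrite -(pair_bigA _ (fun ir B => w sigma (ir, B))) /=.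
  rewrite exchange_big /=; apply: eq_bigr => B _.
  rewrite -(pair_bigA _ (fun i r => w sigma (i, r, B))) /= (bigD1 i0) //=.
  rewrite [X in _ + X]big1.
    rewrite addr0 natr_sum mulr_sumr; apply: eq_bigr => r _.
    by rewrite /w /= eqxx /=; case: (good r _); rewrite ?mulr1 ?mulr0.
  by move=> i /negPf ii0; apply: big1 => r _; rewrite /w /= ii0.
rewrite mulrA mulVf ?mul1r; last first.
  by rewrite pnatr_eq0 -lt0n fact_gt0.
by rewrite -mulr_sumr ler_wpM2l // -natr_sum ler_nat.
Qed.

(** The form of [small_pos] on job indices: the arrival order enters only through the sample [S]. *)
Definition small_job D c (S : {set 'I_n}) (j : 'I_n) : bool :=
  [&& (0 < D)%N, j \notin S &
      (c < #|[set j' in S | (tnth p j <= tnth p j')%R]|)%N].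

Lemma small_pos_arrival D c (sigma : 'S_n) (B : {set 'I_n}) i :
  small_pos D c #|B| (arrival p sigma) i = small_job D c (sample sigma B) (sigma i).
Proof.
rewrite /small_pos /small_job mem_sample -leqNgt tnth_mktuple.
congr [&& _, _ & (_ < _)%N].
rewrite -[LHS](card_imset _ (@perm_inj _ sigma)); apply: eq_card => j.
rewrite -(permKV sigma j) mem_imset ?inE; last exact: perm_inj.
by rewrite mem_sample tnth_mktuple.
Qed.

Lemma minload_strategy (t : params m n) (sigma : 'S_n) (a : n.-tuple 'I_m.+1)
    (D := (2 ^ t.1.1).-1) (c := (rank_base m + t.1.2)%N)
    (S := sample sigma t.2) (v u : R) :
    agrees (@strategy m n) t [::] (zip (arrival p sigma) a) ->
    0 <= u -> (forall j, small_job D c S j -> tnth p j <= u) ->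
    D%:R * (v + u) <= \sum_(j < n | small_job D c S j) tnth p j ->
    (m.+1 - D <= #|[set j | ~~ small_job D c S j & (v <= tnth p j)%R]|)%N ->
  v <= minload (arrival p sigma) a.
Proof.
move=> agr u0 small_le vol cnt.
have tB : (#|t.2| <= n)%N by rewrite -[leqRHS]card_ord max_card.
apply: (@minload_step _ _ _ D c #|t.2| _ _ tB v u) => //.
- move=> i; have := agrees_nth (tnth (zip_tuple (arrival p sigma) a) i) agr.
  move=> /(_ i); rewrite -tnth_nth tnth_zip => H; apply/esym/H.
  by rewrite size1_zip !size_tuple.
- by move=> i; rewrite tnth_mktuple.
- by move=> i; rewrite small_pos_arrival tnth_mktuple; exact: small_le.
- rewrite (le_trans vol) // (reindex_inj (@perm_inj _ sigma)) /=.
  rewrite le_eqVlt; apply/orP; left; apply/eqP.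
  by apply: eq_big => i; rewrite ?small_pos_arrival ?tnth_mktuple.
- apply: leq_trans cnt _.
  rewrite -[leqLHS](card_imset _ (@perm_inj _ sigma^-1%g)); apply: subset_leq_card.
  apply/fintype.subsetP => _ /imsetP[j + ->].
  by rewrite !inE small_pos_arrival tnth_mktuple permKV.
Qed.

End Value.
End Algorithm.

(** * Analysis on sorted inputs *)

Lemma ler_sum_sub (R : numDomainType) (I : finType) (P Q : pred I) (F : I -> R) :
    (forall i, P i -> Q i) -> (forall i, 0 <= F i) ->
  \sum_(i | P i) F i <= \sum_(i | Q i) F i.
Proof.
move=> PQ F0; rewrite [leRHS](bigID P) /= -[leLHS]addr0 lerD ?sumr_ge0 //.
rewrite le_eqVlt; apply/orP; left; apply/eqP; apply: eq_bigl => i.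
by case Pi: (P i); rewrite ?andbF // PQ.
Qed.

Lemma setI_toggle (T : finType) (U A S : {set T}) :
  [disjoint U & A] -> toggle U S :&: A = S :&: A.
Proof.
move=> dUA; apply/setP => x; rewrite !inE; case xA: (x \in A); rewrite ?andbF //.
by rewrite (disjointFl dUA xA) addbF.
Qed.

Section Analysis.
Variables (R : realType) (m n : nat) (p : n.-tuple R) (O : R).
Variable a0 : n.-tuple 'I_m.+1.
Hypothesis p_ge0 : forall i, 0 <= tnth p i.
Hypothesis p_sorted : forall i i' : 'I_n, (i <= i')%N -> tnth p i' <= tnth p i.
Hypothesis O_gt0 : 0 < O.
Hypothesis load_ge : forall j, O <= load p a0 j.

Let s := root4 m.+1.
Let s_gt0 : (0 < s)%N := root4_gt0 m.

(** The jobs of [L] touch at most [#|L|] machines of [a0]; every other machine gets its load [O]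
    from outside [L]. *)
Lemma volume_outside (L : {set 'I_n}) :
  (m.+1 - #|L|)%:R * O <= \sum_(i | i \notin L) tnth p i.
Proof.
pose H := [set tnth a0 i | i in L].
apply: (@le_trans _ _ (\sum_(i | tnth a0 i \notin H) tnth p i)); last first.
  by apply: ler_sum_sub => // i; apply: contraNN => iL; apply: imset_f.
rewrite (partition_big (tnth a0) (fun j => j \notin H)) //=.
apply: (@le_trans _ _ (\sum_(j | j \notin H) O)); last first.
  apply: ler_sum => j jH; rewrite (le_trans (load_ge j)) //.
  by apply: ler_sum_sub => // i /eqP aij; rewrite aij jH eqxx.
rewrite sumr_const -[O *+ _]mulr_natl ler_wpM2r ?(ltW O_gt0) // ler_nat.
have -> : #|fun j => j \notin H| = #|~: H| by apply: eq_card => j; rewrite !inE.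
by rewrite leq_subLR -[leqLHS]card_ord -(cardsC H) leq_add2r leq_imset_card.
Qed.

(** The guess [0] reserves no machine and yields [v] for every rank and sample, so only the factor
    for guessing is lost. *)
Lemma rom_value_greedy v : 0 <= v ->
    (m.+1 <= #|[set j | (v <= tnth p j)%R]|)%N ->
  v / (num_guesses m)%:R <= rom_value (@covering_alg R) m.+1 p.
Proof.
move=> v0 cnt.
have W0 : (0 < num_ranks m * 2 ^ n)%N.
  by rewrite /num_ranks !muln_gt0 !expn_gt0 s_gt0.
have -> : v / (num_guesses m)%:R = v * (num_ranks m * 2 ^ n)%:R /
    (num_guesses m * num_ranks m * 2 ^ n)%:R.
  rewrite -mulnA [(num_guesses m * _)%:R]natrM invfM mulrA mulrAC mulfK //.
  by rewrite pnatr_eq0 -lt0n.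
apply: (@rom_value_ge R m n p p_ge0 ord0 (fun _ _ => true)) => //.
  move=> sigma B r a _ agr.
  apply: (minload_strategy p_ge0 agr (lexx 0)) => //=.
  by rewrite mul0r sumr_ge0.
under eq_bigr => S _ do rewrite sum1_card card_ord.
by rewrite sum_nat_const -cardsT -powersetT card_powerset cardsT card_ord mulnC.
Qed.

(** * Inputs whose job of rank [m] is small *)

Section SmallTail.
Hypothesis tail_small : forall i : 'I_n, (m <= i)%N -> tnth p i < O / (16 * s%:R).

Let L := [set i : 'I_n | O / 16 <= tnth p i].
Let d := (m.+1 - #|L|)%N.

Let tail_lt (i : 'I_n) : (m <= i)%N -> tnth p i < O / 16.
Proof.
move=> /tail_small /lt_le_trans; apply; rewrite ler_wpM2l ?(ltW O_gt0) //.
rewrite lef_pV2 ?posrE ?mulr_gt0 ?ltr0n //.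
by rewrite ler_peMr ?ler0n // ler1n.
Qed.

Let L_lt i : i \in L -> (i < m)%N.
Proof. by rewrite inE ltnNge => Li; apply/negP => /tail_lt; rewrite ltNge Li. Qed.

Let card_L : (#|L| <= m)%N.
Proof.
apply: leq_trans (_ : #|[set i : 'I_n | (i < m)%N]| <= _)%N; last first.
  by rewrite card_ord_lt geq_minl.
by apply/subset_leq_card/fintype.subsetP => i /L_lt; rewrite inE.
Qed.

(** Outside [L] lies volume at least [d * O]. The at most [d - 1] such jobs of index below [m] take
    at most [(d - 1) * O / 16], the next [s] jobs at most [O / 16]. *)
Let tail_volume : d%:R * O / 2 <= \sum_(i < n | (m + s <= i)%N) tnth p i.
Proof.
have := volume_outside L; rewrite -/d.
rewrite (bigID (fun i : 'I_n => (i < m)%N)) /=.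
rewrite [X in _ <= _ + X](bigID (fun i : 'I_n => (i < m + s)%N)) /=.
have : \sum_(i < n | (i \notin L) && (i < m)%N) tnth p i <= (d%:R - 1) * (O / 16).
  apply: (@le_trans _ _ (\sum_(i < n | (i \notin L) && (i < m)%N) (O / 16))).
    by apply: ler_sum => i /andP[]; rewrite inE -ltNge => /ltW.
  rewrite sumr_const -[_ *+ #|_|]mulr_natl ler_wpM2r ?divr_ge0 ?(ltW O_gt0) //.
  have -> : d%:R - 1 = (m - #|L|)%:R :> R.
    by rewrite /d subSn // -natr1 addrK.
  rewrite ler_nat; set X := #|_|.
  have -> : X = #|[set i : 'I_n | (i < m)%N] :\: L|.
    by apply: eq_card => i; rewrite finset.in_setD finset.in_set unfold_in.
  rewrite cardsD (finset.setIidPr _) ?card_ord_lt ?leq_sub2r ?geq_minl //.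
  by apply/fintype.subsetP => i /L_lt; rewrite inE.
have : \sum_(i < n | (i \notin L) && ~~ (i < m)%N && (i < m + s)%N) tnth p i <= O / 16.
  apply: (@le_trans _ _ (\sum_(i < n | (i \notin L) && ~~ (i < m)%N && (i < m + s)%N)
     (O / (16 * s%:R)))).
    by apply: ler_sum => i /andP[/andP[_]]; rewrite -leqNgt => /tail_small /ltW.
  rewrite sumr_const -[_ *+ #|_|]mulr_natl.
  apply: (@le_trans _ _ (s%:R * (O / (16 * s%:R)))); last first.
    rewrite le_eqVlt; apply/orP; left; apply/eqP; field.
    by rewrite pnatr_eq0 -lt0n.
  rewrite ler_wpM2r ?divr_ge0 ?mulr_ge0 ?ler0n ?(ltW O_gt0) // ler_nat.
  apply: leq_trans (_ : #|[set i : 'I_n | (i < m + s)%N] :\: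
                          [set i : 'I_n | (i < m)%N]| <= _)%N.
    apply/subset_leq_card/fintype.subsetP => i; rewrite !inE.
    by case/andP => /andP[_ ->] ->.
  rewrite cardsD (finset.setIidPr _) ?card_ord_lt; first by lia.
  by apply/fintype.subsetP => i; rewrite !inE; lia.
have : \sum_(i < n | (i \notin L) && ~~ (i < m)%N && ~~ (i < m + s)%N) tnth p i
   <= \sum_(i < n | (m + s <= i)%N) tnth p i.
  by apply: ler_sum_sub => // i; rewrite -!leqNgt => /andP[].
have d1 : 1 <= d%:R :> R by rewrite ler1n /d; lia.
by move: O_gt0; nra.
Qed.

Let n_ge : (m + s <= n)%N.
Proof.
rewrite leqNgt; apply/negP => ns; move: tail_volume; rewrite big_pred0 => [|i].
  apply/negP; rewrite -ltNge divr_gt0 // mulr_gt0 // ltr0n /d; lia.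
by apply/negbTE; rewrite -ltnNge; have := ltn_ord i; lia.
Qed.

(** As [p] is sorted, [#|S :&: below j|] is the rank of [j] in the sample, with ties broken by
    index. *)
Let below (j : 'I_n) := [set i : 'I_n | (i < j)%N].
Let tail_ok (S : {set 'I_n}) :=
  d%:R * O / 4 <= \sum_(i < n | (i \notin S) && (m + s <= i)%N) tnth p i.
Let window (j : 'I_n) (S : {set 'I_n}) :=
  (rank_base m <= #|S :&: below j| < rank_base m + num_ranks m)%N.
Let good (r : 'I_(num_ranks m)) (S : {set 'I_n}) :=
  tail_ok S && [exists j : 'I_n, [&& (m <= j < m + s)%N, j \in S &
                                     #|S :&: below j| == (rank_base m + r)%N]].

(** Chebyshev with [u = s ^ 2] applies because [j < m + s <= 2 * s ^ 4]. *)
Let window_likely (j : 'I_n) : (m <= j < m + s)%N ->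
  (2 ^ n <= 2 * #|[set S | window j S]|)%N.
Proof.
move=> /andP[mj js]; have jb : #|below j| = j.
  by rewrite card_ord_lt; apply/minn_idPl/ltnW.
have u0 : (0 < s ^ 2)%N by rewrite expn_gt0 s_gt0.
have su : (s <= s ^ 2)%N by rewrite -[leqLHS]expn1 leq_pexp2l.
have sm : (s <= m.+1)%N := root4_le m.+1.
have m4 : (m.+1 <= s ^ 4)%N := root4P m.+1.
have := @chebyshev_subset _ (below j) (s ^ 2) u0.
rewrite card_ord jb -expnM => /(_ _)/leq_trans; apply; first by lia.
rewrite leq_mul2l; apply: subset_leq_card; apply/fintype.subsetP => S.
rewrite !inE /window /rank_base /num_ranks -/s => /andP[].
by move: #|_| => X; move: su u0; move: (s ^ 2)%N => u; lia.
Qed.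

(** One factor 2 each for the window, for [j \in S] and for the tail. These concern disjoint sets of
    indices, so toggling one of them preserves the earlier events. *)
Let good_likely (j : 'I_n) : (m <= j < m + s)%N ->
  (2 ^ n <= 8 * #|[set S | window j S && (j \in S) && tail_ok S]|)%N.
Proof.
move=> jJ; have h1 := window_likely jJ.
have h2 : (#|[set S | window j S]| <= 2 * #|[set S | window j S && (j \in S)]|)%N.
  apply: (card_le_double (toggleK [set j])) => S.
    rewrite /window setI_toggle //; rewrite disjoints1 inE; lia.
  by rewrite !inE eqxx addbT orbN.
have h3 : (#|[set S | window j S && (j \in S)]| <=
    2 * #|[set S | window j S && (j \in S) && tail_ok S]|)%N.
  pose U := [set i : 'I_n | (m + s <= i)%N].
  apply: (card_le_double (toggleK U)) => S.
    rewrite /window setI_toggle; last first.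
      by rewrite disjoint_subset; apply/fintype.subsetP => i; rewrite !inE; lia.
    congr (_ && _); rewrite !inE (_ : (m + s <= j)%N = false) ?addbF //.
    lia.
  (* Toggling [U] swaps sampled and unsampled tail jobs, and one of the two halves has volume at
     least [d * O / 4]. *)
  have := tail_volume; rewrite (bigID (mem S)) /= /tail_ok => vol.
  have -> : \sum_(i < n | (i \notin toggle U S) && (m + s <= i)%N) tnth p i =
      \sum_(i < n | (m + s <= i)%N && (i \in S)) tnth p i.
    apply: eq_bigl => i; rewrite !inE; case: (m + s <= i)%N; rewrite ?andbF //.
    by rewrite addbT negbK andbT.
  rewrite (eq_bigl (fun i : 'I_n => (m + s <= i)%N && (i \notin S))) => [|i].
    by apply/orP; case: (leP (d%:R * O / 4)
      (\sum_(i < n | (m + s <= i)%N && (i \notin S)) tnth p i)) => h;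
      [left | right; lra].
  by rewrite andbC.
lia.
Qed.

(** Distinct sampled jobs have distinct ranks in the sample, so each such [j] gives its own good
    [r]. *)
Let card_good (S : {set 'I_n}) :
  (#|[set j : 'I_n | (m <= j < m + s)%N && (window j S && (j \in S) && tail_ok S)]|
    <= \sum_r good r S)%N.
Proof.
have W0 : (0 < num_ranks m)%N by rewrite /num_ranks muln_gt0 expn_gt0 s_gt0.
set E := [set j | _].
pose f (j : 'I_n) := insubd (Ordinal W0) (#|S :&: below j| - rank_base m)%N.
have fE j : j \in E -> (rank_base m + f j)%N = #|S :&: below j|.
  rewrite inE => /and3P[_ /andP[/andP[w1 w2] _] _].
  by rewrite val_insubd ifT ?subnKC //; lia.
have finj : {in E &, injective f}.
  suff lt_ne (j j' : 'I_n) : j \in E -> j' \in E -> f j = f j' -> ~~ (j < j')%N.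
    move=> j j' jE j'E ff; apply/val_inj/eqP => /=; rewrite eqn_leq leqNgt.
    by rewrite lt_ne //= leqNgt lt_ne.
  move=> jE j'E ff; apply/negP => jj'.
  have : (#|S :&: below j| < #|S :&: below j'|)%N.
    apply/proper_card/properP; split.
      by apply/fintype.subsetP => i; rewrite !inE => /andP[->]; lia.
    exists j; rewrite !inE ?ltnn ?andbF //.
    by move: jE; rewrite inE jj' andbT; case/and3P => _ /andP[].
  by rewrite -!fE // ff ltnn.
rewrite -(card_in_imset finj).
have -> : (\sum_r good r S = #|[set r | good r S]|)%N.
  rewrite -sum1_card big_mkcond [RHS]big_mkcond /=; apply: eq_bigr => r _.
  by rewrite inE; case: good.
apply/subset_leq_card/fintype.subsetP => _ /imsetP[j jE ->].
rewrite inE /good; move: (jE); rewrite inE => /and3P[jJ /andP[_ jS] ->] /=.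
by apply/existsP; exists j; rewrite jJ jS fE /=.
Qed.

(** Sum over [j] first: all [s] indices from [m] on exist by [n_ge], and each succeeds for at least
    an eighth of all samples. *)
Let sum_good : (s * 2 ^ n <= 8 * \sum_S \sum_r good r S)%N.
Proof.
apply: leq_trans (_ : _ <= 8 * \sum_S \sum_(j < n | (m <= j < m + s)%N)
   (window j S && (j \in S) && tail_ok S))%N _; last first.
  rewrite leq_mul2l; apply: leq_sum => S _; apply: leq_trans (card_good S).
  rewrite -sum1_card [leqLHS]big_mkcond [leqRHS]big_mkcond.
  by apply: leq_sum => j _; rewrite inE; case: ifP => //=; case: (_ && _ && _).
rewrite exchange_big big_distrr /=.
apply: leq_trans (_ : _ <= \sum_(j < n | (m <= j < m + s)%N) 2 ^ n)%N _; last first.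
  apply: leq_sum => j jJ; rewrite (leq_trans (good_likely jJ)) // leq_mul2l /=.
  rewrite -sum1_card big_mkcond /=; apply: leq_sum => S _; rewrite inE.
  by case: (_ && _ && _).
rewrite sum_nat_const leq_mul2r; apply/orP; right.
have -> : #|fun j : 'I_n => (m <= j < m + s)%N| =
    #|[set i : 'I_n | (i < m + s)%N] :\: [set i : 'I_n | (i < m)%N]|.
  by apply: eq_card => j; rewrite !inE -leqNgt.
rewrite cardsD (finset.setIidPr _) ?card_ord_lt; first by lia.
by apply/fintype.subsetP => i; rewrite !inE; lia.
Qed.

Let minload_good (i0 : 'I_(num_guesses m)) (D := (2 ^ i0).-1) sigma B r
    (a : n.-tuple 'I_m.+1) : (d <= D <= 2 * d)%N ->
    good r (sample sigma B) ->
    agrees (@strategy R m n) (i0, r, B) [::] (zip (arrival p sigma) a) ->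
  O / 16 <= minload (arrival p sigma) a.
Proof.
move=> /andP[dD Dd] /andP[tok /existsP[j /and3P[/andP[mj js] jS /eqP rk]]] agr.
(* If [x] is larger than [j], all sample jobs at least as large as [x] precede [j]; these are too
   few for [x] to be small. *)
have small_p x : small_job p D (rank_base m + r) (sample sigma B) x ->
    tnth p x <= tnth p j.
  case/and3P => _ _; rewrite -rk leNgt; apply: contraTN => px; rewrite -leqNgt.
  apply/subset_leq_card/fintype.subsetP => i; rewrite !inE => /andP[-> /=].
  by rewrite ltnNge => xi; apply/negP => /p_sorted ij; move: px; lra.
have O16 : 0 <= O / 16 by rewrite divr_ge0 // ltW.
apply: (minload_strategy p_ge0 agr O16) => /=.
- by move=> x /small_p /le_trans; apply; apply/ltW/tail_lt.
(* Here [v = u = O / 16], and [D <= 2 * d]. *)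
- apply: (@le_trans _ _ (d%:R * O / 4)).
    have : D%:R <= 2 * d%:R :> R by rewrite -natrM ler_nat.
    by move: O_gt0; rewrite -/D; nra.
  apply: le_trans tok _; apply: ler_sum_sub => // i /andP[iS msi].
  apply/and3P; split => //; first by rewrite -/D; lia.
  rewrite -rk; apply/proper_card/properP; split.
    apply/fintype.subsetP => x; rewrite !inE => /andP[-> /= xj].
    by apply: p_sorted; lia.
  exists j; rewrite !inE ?ltnn ?andbF // jS; apply: p_sorted; lia.
(* As [d <= D], the jobs of [L] suffice; they exceed the threshold [tnth p j] and hence are never
   small. *)
- apply: leq_trans (_ : m.+1 - D <= #|L|)%N _; first by rewrite /d in dD; lia.
  apply/subset_leq_card/fintype.subsetP => i; rewrite !inE => Li; rewrite Li andbT.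
  apply/negP => /small_p; apply/negP; rewrite -ltNge.
  by apply: lt_le_trans Li; exact: tail_lt.
Qed.

(** The constant is [384 = 16 * 3 * 8], from the load, the number of ranks and [sum_good]. *)
Lemma rom_value_small_tail :
  O / (384 * s%:R * (num_guesses m)%:R) <= rom_value (@covering_alg R) m.+1 p.
Proof.
have d0 : (0 < d)%N by rewrite /d; lia.
(* Rounding the logarithm down and adding 1 gives a guess between [d] and [2 * d], even after the
   subtraction of 1. *)
have i0P : ((trunc_log 2 d).+1 < num_guesses m)%N.
  by rewrite ltnS ltnS leq_trunc_log // /d; lia.
have dD : (d <= (2 ^ (Ordinal i0P)).-1 <= 2 * d)%N.
  have /= := trunc_log_bounds (isT : 1 < 2)%N d0; rewrite expnS; lia.
have O16 : 0 <= O / 16 by rewrite divr_ge0 // ltW.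
apply: le_trans (rom_value_ge p_ge0 O16
  (fun sigma B r a => minload_good dD) (leqnn _)).
have := sum_good; set N := (\sum_S _)%N; rewrite -(ler_nat R).
rewrite [(s * _)%:R]natrM [(8 * _)%:R]natrM.
have n2 : 0 < (2 ^ n)%:R :> R by rewrite ltr0n expn_gt0.
have s0 : 0 < s%:R :> R by rewrite ltr0n.
have g0 : 0 < (num_guesses m)%:R :> R by rewrite ltr0n.
rewrite [(_ * 2 ^ n)%:R]natrM [(num_guesses m * _)%:R]natrM /num_ranks -/s.
rewrite [(3 * _)%:R]natrM [(s ^ 2)%:R]natrX.
move: (2 ^ n)%:R n2 => e e0; move: s%:R s0 => x x0 NP.
move: (num_guesses m)%:R g0 => g g0.
rewrite ler_pdivlMr ?mulr_gt0 ?exprn_gt0 //.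
have -> : O / (384 * x * g) * (g * (3 * x ^+ 2) * e) = O / 16 * (x * e / 8).
  by field; rewrite !gt_eqF.
rewrite ler_wpM2l //; lra.
Qed.

End SmallTail.

Lemma rom_value_ge_opt :
  O / (384 * s%:R * (num_guesses m)%:R) <= rom_value (@covering_alg R) m.+1 p.
Proof.
case: (pickP [pred i : 'I_n | (m <= i)%N && (O / (16 * s%:R) <= tnth p i)]) => /=.
  (* By sortedness the first [m + 1] jobs all have size at least [O / (16 * s)], so plain greedy is
     enough. *)
  move=> i /andP[mi pi]; have s0 : 0 < s%:R :> R by rewrite ltr0n.
  have v0 : 0 <= O / (16 * s%:R) by rewrite divr_ge0 ?mulr_ge0 ?ltW.
  apply: le_trans (rom_value_greedy v0 _).
    rewrite -[leRHS]mulrA -invfM ler_wpM2l ?(ltW O_gt0) // lef_pV2 ?posrE //;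
      rewrite ?mulr_gt0 ?ltr0n //.
    by rewrite ler_wpM2r ?ler0n // ler_wpM2r ?ler0n // ler_nat.
  apply: leq_trans (_ : #|[set j : 'I_n | (j < i.+1)%N]| <= _)%N.
    by rewrite card_ord_lt leq_min ltnS mi; exact: leq_ltn_trans mi _.
  apply/subset_leq_card/fintype.subsetP => j; rewrite !inE ltnS => /p_sorted.
  exact: le_trans.
move=> none; apply: rom_value_small_tail => i mi.
by have /= := none i; rewrite mi /= leNgt => /negbFE.
Qed.

End Analysis.

(** * Competitive ratio *)

(** Relabelling the jobs only translates the uniform permutation; hence the input may be taken
    sorted. *)
Lemma rom_value_arrival (R : realType) (A : online_alg R) m n (p : n.-tuple R)
    (rho : 'S_n) :
  rom_value A m (arrival p rho) = rom_value A m p.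
Proof.
rewrite /rom_value; congr (_ * _); rewrite [RHS](reindex_inj (mulIg rho)) /=.
apply: eq_bigr => sigma _; congr alg_value; apply: eq_from_tnth => i.
by rewrite !tnth_mktuple permM.
Qed.

Lemma sorted_arrival (R : realType) n (p : n.-tuple R) : exists rho : 'S_n,
  forall i i' : 'I_n, (i <= i')%N ->
    tnth (arrival p rho) i' <= tnth (arrival p rho) i.
Proof.
have /tuple_permP[rho pE] : perm_eq (sort >=%R p) p by rewrite perm_sort.
exists rho => i i' ii'; have so := sort_sorted (@ge_total _ R) p.
rewrite !(tnth_nth 0) /arrival -pE.
by apply: (sorted_leq_nth ge_trans ge_refl 0 so); rewrite ?inE ?size_sort ?size_tuple.
Qed.

Lemma OPT_witness (R : realType) m n (p : n.-tuple R) :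
    (forall i, 0 <= tnth p i) ->
  exists a : n.-tuple 'I_m.+1, forall j, OPT m.+1 p <= load p a j.
Proof.
move=> p0; rewrite /OPT (@bigmax_eq_arg _ _ _ _ [tuple of nseq n ord0] predT) //.
  by eexists => j; exact: bigmin_le.
by move=> a _; exact: minload_ge0.
Qed.

Lemma rom_value_OPT (R : realType) m n (p : n.-tuple R) :
    (forall i, 0 <= tnth p i) -> 0 < OPT m.+1 p ->
  OPT m.+1 p / (384 * (root4 m.+1)%:R * (num_guesses m)%:R)
    <= rom_value (@covering_alg R) m.+1 p.
Proof.
move=> p0 O0; have [a aP] := OPT_witness m p0; have [rho srt] := sorted_arrival p.
rewrite -(rom_value_arrival _ _ _ rho).
apply: (rom_value_ge_opt (a0 := [tuple tnth a (rho i) | i < n])) => // [i|j].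
  by rewrite tnth_mktuple.
rewrite (le_trans (aP j)) // /load (reindex_inj (@perm_inj _ rho)) /=.
rewrite le_eqVlt; apply/orP; left; apply/eqP.
by apply: eq_big => i; rewrite !tnth_mktuple.
Qed.

Lemma ln2_ge (R : realType) : 2^-1 <= ln (2 : R).
Proof.
have := @le_ln1Dx R (- 2^-1); rewrite (_ : 1 + - 2^-1 = 2^-1); last by lra.
by rewrite lnV ?posrE // => /(_ _); lra.
Qed.

Lemma root4_powR (R : realType) m : (0 < m)%N ->
  1 <= m%:R `^ (4%:R^-1) :> R /\ (root4 m)%:R <= 2 * (m%:R `^ (4%:R^-1)) :> R.
Proof.
move=> m0; set y := _ `^ _.
have y0 : 0 <= y by exact: powR_ge0.
have y4 : y ^+ 4 = m%:R.
  by rewrite -powR_mulrn // -powRrM mulVf ?powRr1 ?ler0n // pnatr_eq0.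
have y1 : 1 <= y by rewrite -(@ler_pXn2r _ 4) ?nnegrE // y4 expr1n ler1n.
split => //; have sy : (root4 m).-1%:R <= y.
  rewrite -(@ler_pXn2r _ 4) ?nnegrE ?ler0n // y4 -natrX ler_nat.
  exact/ltnW/root4_pred.
have : (root4 m)%:R <= (root4 m).-1%:R + 1 :> R by rewrite natr1 ler_nat leqSpred.
lra.
Qed.

(** From [1/2 <= ln 2]: the truncated logarithm is at most [2 * ln m.+1], and the extra 2 at most
    [4 * ln m.+1]. *)
Lemma num_guesses_ln (R : realType) m : (2 <= m.+1)%N ->
  (num_guesses m)%:R <= 6 * ln (m.+1%:R : R).
Proof.
move=> m2; have l2 := ln2_ge R.
have lm : ln (2 : R) <= ln (m.+1%:R : R) by rewrite ler_ln ?posrE // ler_nat.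
have : ln ((2 ^ trunc_log 2 m.+1)%:R : R) <= ln (m.+1%:R : R).
  by rewrite ler_ln ?posrE ?ltr0n ?expn_gt0 // ler_nat trunc_logP.
rewrite natrX lnXn // -[_ *+ trunc_log _ _]mulr_natl.
have -> : (num_guesses m)%:R = (trunc_log 2 m.+1)%:R + 2 :> R.
  by rewrite -natrD addn2.
move: (trunc_log _ _) => T; have := ler_wpM2l (ler0n R T) l2; lra.
Qed.

Theorem theorem1 (R : realType) :
  exists A : online_alg R, valid_alg A /\
    exists (C : R) (k : nat), 0 < C /\
      forall m : nat, (2 <= m)%N ->
        (rom_comp_ratio A m <=
         (C * (m%:R `^ (4%:R^-1)) * (ln (m%:R : R)) ^+ k)%:E)%E.
Proof.
exists (@covering_alg R); split; first exact: covering_alg_valid.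
(* [4608 = 384 * 2 * 6], with 2 from [root4_powR] and 6 from [num_guesses_ln]. *)
exists 4608, 1%N; split; first by rewrite ltr0n.
case=> [//|m] m2.
have [y1 sy] := @root4_powR R m.+1 isT; have gl := num_guesses_ln R m2.
have l2 := ln2_ge R.
have lm : ln (2 : R) <= ln (m.+1%:R : R) by rewrite ler_ln ?posrE // ler_nat.
have s0 : 0 < (root4 m.+1)%:R :> R by rewrite ltr0n root4_gt0.
have g0 : 0 < (num_guesses m)%:R :> R by [].
rewrite expr1; move: (m.+1%:R `^ _) y1 sy => y y1 sy.
set K := 384 * (root4 m.+1)%:R * (num_guesses m)%:R : R.
have K0 : 0 < K by rewrite !mulr_gt0.
have bK : K <= 4608 * y * ln (m.+1%:R : R).
  by rewrite /K; move: (ln _) gl lm l2 => l gl lm l2; nra.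
have b1 : 1 <= 4608 * y * ln (m.+1%:R : R) by nra.
move: (4608 * y * _) bK b1 => b bK b1.
apply: ub_ereal_sup => _ [n [p [p0 ->]]]; rewrite /Defs.ratio.
have [O0|O0] : OPT m.+1 p = 0 \/ 0 < OPT m.+1 p.
- by have := bigmax_ge_id (index_enum _) 0 predT (@minload R m.+1 n p);
    rewrite -/(OPT _ _) le_eqVlt => /predU1P[]; auto.
(* With optimum 0 the ratio is 1 or 0, so it is enough that the bound is at least 1. *)
- rewrite O0 eqxx mul0r; case: ifP => _; rewrite lee_fin //.
  exact: le_trans ler01 b1.
have := rom_value_OPT p0 O0; rewrite -/K; set v := rom_value _ _ _ => vP.
have v0 : 0 < v by apply: lt_le_trans vP; rewrite divr_gt0.
rewrite gt_eqF // lee_fin ler_pdivrMr //; rewrite ler_pdivrMr // in vP.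
by rewrite (le_trans vP) // mulrC ler_wpM2r // ltW.
Qed.
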